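(* Let $F$ be a field, let $\lambda\in F$ be nonzero, and let $(V,\{\!\{\cdot,\cdot\}\!\})$ be a finite-dimensional $\lambda$-double Lie algebra over $F$ with basis $e_1,\dots,e_n$. Let $A=\mathrm{As}\langle e_1,\dots,e_n\rangle$ be the free associative algebra on $e_1,\dots,e_n$. Then the equalities $$\{\!\{a,bc\}\!\}=(b\otimes 1)\{\!\{a,c\}\!\}+\{\!\{a,b\}\!\}(1\otimes c),\qquad \{\!\{ab,c\}\!\}=(1\otimes a)\{\!\{b,c\}\!\}+\{\!\{a,c\}\!\}(b\otimes 1)\qquad (a,b,c\in A)$$ define a modified double Poisson algebra structure on $A$; that is, the unique double bracket on $A$ which extends the double bracket of $V$ (where $V\subset A$ is the span of the generators) and satisfies these two equalities is a modified double Poisson bracket on $A$.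
   Context: A double bracket on a vector space $V$ is a linear map $V\otimes V\to V\otimes V$, $a\otimes b\mapsto\{\!\{a,b\}\!\}$. For $u\in V^{\otimes n}$ and $\sigma\in S_n$, $u^\sigma$ denotes $u$ with tensor factors permuted by $\sigma$ (so $(x\otimes y)^{(12)}=y\otimes x$, $(x\otimes y\otimes z)^{(12)}=y\otimes x\otimes z$, $(x\otimes y\otimes z)^{(23)}=x\otimes z\otimes y$). Put, extended linearly, $\{\!\{a,b\otimes c\}\!\}_L=\{\!\{a,b\}\!\}\otimes c$, $\{\!\{a,b\otimes c\}\!\}_R=b\otimes\{\!\{a,c\}\!\}$, $\{\!\{a\otimes b,c\}\!\}_L=(\{\!\{a,c\}\!\}\otimes b)^{(23)}$. A $\lambda$-double Lie algebra ($\lambda\in F$) is a vector space $V$ with a double bracket such that for all $a,b,c\in V$: $$\{\!\{a,b\}\!\}+\{\!\{b,a\}\!\}^{(12)}=\lambda(a\otimes b-b\otimes a),$$ $$\{\!\{a,\{\!\{b,c\}\!\}\}\!\}_L-\{\!\{b,\{\!\{a,c\}\!\}\}\!\}_R-\{\!\{\{\!\{a,b\}\!\},c\}\!\}_L=-\lambda(b\otimes\{\!\{a,c\}\!\})^{(12)}.$$ Let $A$ be an associative algebra with product $\mu(a\otimes b)=ab$. A modified double Poisson bracket on $A$ is a double bracket $\{\!\{\cdot,\cdot\}\!\}$ on $A$ such that, with $\{a,b\}:=\mu(\{\!\{a,b\}\!\})$, for all $a,b,c\in A$: (1) $\{\!\{a,bc\}\!\}=(b\otimes 1)\{\!\{a,c\}\!\}+\{\!\{a,b\}\!\}(1\otimes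 c)$; (2) $\{\!\{ab,c\}\!\}=(1\otimes a)\{\!\{b,c\}\!\}+\{\!\{a,c\}\!\}(b\otimes 1)$; (3) $\{a,\{b,c\}\}-\{b,\{a,c\}\}=\{\{a,b\},c\}$; (4) $\{a,b\}+\{b,a\}\in[A,A]$. Products in $A\otimes A$ are componentwise, and $[A,A]$ is the linear span of all commutators $xy-yx$, $x,y\in A$. *)

(* Defs.v *)
From HB Require Import structures.
From mathcomp Require Import all_boot all_order all_algebra.
From mathcomp Require Import ring_quotient sesquilinear.
From mathcomp Require Import boolp finmap.
From mathcomp Require Import monalg.

Set Implicit Arguments.
Unset Strict Implicit.
Unset Printing Implicit Defensive.

Import GRing.Theory.
Local Open Scope ring_scope.

Section Span.
Variables (F : fieldType) (M : lmodType F).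

Definition in_span (S : M -> Prop) (x : M) : Prop :=
  exists s : seq (F * M),
    (forall p, p \in s -> S p.2) /\ x = \sum_(p <- s) p.1 *: p.2.

Variable S : M -> Prop.

Lemma in_span_gen x : S x -> in_span S x.
Proof.
move=> Sx; exists [:: (1, x)]; rewrite big_seq1 scale1r; split=> //.
by move=> p /[!inE] /eqP ->.
Qed.

Lemma in_span0 : in_span S 0.
Proof. by exists [::]; rewrite big_nil. Qed.

Lemma in_spanD x y : in_span S x -> in_span S y -> in_span S (x + y).
Proof.
move=> [s [Ss ->]] [t [St ->]]; exists (s ++ t); rewrite big_cat; split=> //.
by move=> p; rewrite mem_cat => /orP[/Ss|/St].
Qed.

Lemma in_spanZ a x : in_span S x -> in_span S (a *: x).
Proof.
move=> [s [Ss ->]]; exists [seq (a * p.1, p.2) | p <- s]; split.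
  by move=> _ /mapP[p /Ss Sp ->].
by rewrite big_map scaler_sumr; apply: eq_bigr => p _; rewrite scalerA.
Qed.

Lemma in_spanB x y : in_span S x -> in_span S y -> in_span S (x - y).
Proof. by move=> Sx Sy; rewrite -scaleN1r; apply/in_spanD/in_spanZ. Qed.

End Span.

(* The tensor product over F: the quotient of the free module on U * V by the *)
(* span of the bilinearity relations.                                         *)
Section TensorDef.
Variables (F : fieldType) (U V : lmodType F).

Local Notation free := {malg F[(U * V)%type]}.
Local Notation "[[ u , v ]]" := (<< (u, v) >> : free).

Inductive tensor_relator : free -> Prop :=
| TensorDl u u' v : tensor_relator ([[u + u', v]] - [[u, v]] - [[u', v]])
| TensorDr u v v' : tensor_relator ([[u, v + v']] - [[u, v]] - [[u, v']])
| TensorZl a u v : tensor_relator ([[a *: u, v]] - a *: [[u, v]])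
| TensorZr a u v : tensor_relator ([[u, a *: v]] - a *: [[u, v]]).

Definition tensor_rel : {pred free} := fun x => `[< in_span tensor_relator x >].

Fact tensor_rel_zmod : zmod_closed tensor_rel.
Proof.
split; first by apply/asboolP/in_span0.
by move=> x y /asboolP Sx /asboolP Sy; apply/asboolP/in_spanB.
Qed.

HB.instance Definition _ :=
  GRing.isZmodClosed.Build free tensor_rel tensor_rel_zmod.

Definition tensor := Quotient.quot tensor_rel.

HB.instance Definition _ := Choice.on tensor.
HB.instance Definition _ := GRing.Zmodule.on tensor.
HB.instance Definition _ : EqQuotient free (Quotient.equiv tensor_rel) tensor
  := EqQuotient.on tensor.
HB.instance Definition _ := ZmodQuotient.on tensor.

Local Open Scope quotient_scope.

Definition tensor_scale (a : F) (x : tensor) : tensor :=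
  \pi_tensor (a *: repr x).

Lemma tensor_scale_pi a (x : free) :
  tensor_scale a (\pi_tensor x) = \pi_tensor (a *: x).
Proof.
apply/eqmodP; rewrite /= /Quotient.equiv -scalerBr; apply/asboolP/in_spanZ/asboolP.
by have /eqmodP := reprK (\pi_tensor x).
Qed.

Fact tensor_scalerA a b x :
  tensor_scale a (tensor_scale b x) = tensor_scale (a * b) x.
Proof. by rewrite -(reprK x) [tensor_scale b _]tensor_scale_pi !tensor_scale_pi scalerA. Qed.

Fact tensor_scale1r : left_id 1 tensor_scale.
Proof. by move=> x; rewrite -(reprK x) tensor_scale_pi scale1r. Qed.

Fact tensor_scalerDr : right_distributive tensor_scale +%R.
Proof.
move=> a x y; rewrite -(reprK x) -(reprK y).
by rewrite -raddfD !tensor_scale_pi scalerDr raddfD.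
Qed.

Fact tensor_scalerDl x : {morph tensor_scale^~ x : a b / a + b}.
Proof.
by move=> a b; rewrite -(reprK x) !tensor_scale_pi scalerDl raddfD.
Qed.

HB.instance Definition _ := GRing.Zmodule_isLmodule.Build F tensor
  tensor_scalerA tensor_scale1r tensor_scalerDr tensor_scalerDl.

Definition tens (u : U) (v : V) : tensor := \pi_tensor [[u, v]].

End TensorDef.

Notation "u *t v" := (tens u v) (at level 40, left associativity) : ring_scope.
Notation bilinear_map f := (bilinear_for *:%R *:%R f).

Section TensorTheory.
Variables (F : fieldType) (U V : lmodType F).
Implicit Types (u : U) (v : V).

Local Notation free := {malg F[(U * V)%type]}.
Local Open Scope quotient_scope.

Lemma tensDl u u' v : (u + u') *t v = u *t v + u' *t v.
Proof.
rewrite /tens -raddfD; apply/eqmodP; rewrite /= /Quotient.equiv opprD addrA.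
exact/asboolP/in_span_gen/TensorDl.
Qed.

Lemma tensDr u v v' : u *t (v + v') = u *t v + u *t v'.
Proof.
rewrite /tens -raddfD; apply/eqmodP; rewrite /= /Quotient.equiv opprD addrA.
exact/asboolP/in_span_gen/TensorDr.
Qed.

Lemma tensZl a u v : (a *: u) *t v = a *: (u *t v).
Proof.
rewrite [RHS]tensor_scale_pi; apply/eqmodP; rewrite /= /Quotient.equiv.
exact/asboolP/in_span_gen/TensorZl.
Qed.

Lemma tensZr a u v : u *t (a *: v) = a *: (u *t v).
Proof.
rewrite [RHS]tensor_scale_pi; apply/eqmodP; rewrite /= /Quotient.equiv.
exact/asboolP/in_span_gen/TensorZr.
Qed.

Fact tens_bilinear : bilinear_map (@tens F U V).
Proof.
split=> [v a u u'|u a v v']; first by rewrite tensDl tensZl.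
by rewrite tensDr tensZr.
Qed.

HB.instance Definition _ := bilinear_isBilinear.Build F U V (tensor U V)
  *:%R *:%R (@tens F U V) tens_bilinear.

Lemma tensorE (x : tensor U V) :
  x = \sum_(p <- msupp (repr x)) (repr x)@_p *: (p.1 *t p.2).
Proof.
rewrite -[LHS]reprK {1}[repr x]monalgE raddf_sum; apply: eq_bigr => -[u v] _.
rewrite [RHS]tensor_scale_pi; congr (\pi _); apply/malgP => k.
by rewrite mcoeffZ !mcoeffU mulr_natr.
Qed.

Section Lift.
Variables (W : lmodType F).

(* For bilinear f, the induced linear map u *t v |-> f u v (see tliftE,       *)
(* tlift_linear and tlift_unique); tlift f is irrelevant otherwise.           *)
Definition tlift (f : U -> V -> W) (x : tensor U V) : W :=
  \sum_(p <- msupp (repr x)) (repr x)@_p *: f p.1 p.2.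

Lemma tlift_comb a f g h (x : tensor U V) :
    (forall u v, f u v = a *: g u v + h u v) ->
  tlift f x = a *: tlift g x + tlift h x.
Proof.
move=> fE; rewrite /tlift scaler_sumr -big_split; apply: eq_bigr => p _ /=.
by rewrite fE scalerDr !scalerA mulrC.
Qed.

Variables (f : U -> V -> W) (f_bil : bilinear_map f).

Let mlift (g : free) : W := \sum_(p <- msupp g) g@_p *: f p.1 p.2.

Let mliftEw (d : {fset U * V}) g : (msupp g `<=` d)%fset ->
  mlift g = \sum_(p <- d) g@_p *: f p.1 p.2.
Proof.
move=> le; rewrite [LHS](big_fset_incl _ le) => //= x xd /mcoeff_outdom ->.
by rewrite scale0r.
Qed.

Let mlift_linear a g h : mlift (a *: g + h) = a *: mlift g + mlift h.
Proof.
pose d := (msupp (a *: g + h) `|` msupp g `|` msupp h)%fset.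
rewrite !(@mliftEw d) /d; first last.
- by rewrite -fsetUA fsubsetUl.
- by rewrite fsetUAC fsubsetUr.
- by rewrite fsubsetUr.
rewrite scaler_sumr -big_split; apply: eq_bigr => p _ /=.
by rewrite mcoeffD mcoeffZ scalerDl scalerA.
Qed.

Let mliftU u v : mlift << (u, v) >> = f u v.
Proof. by rewrite (mliftEw msuppU_le) big_seq_fset1 mcoeffUU scale1r. Qed.

Let mlift0 : mlift 0 = 0.
Proof. by rewrite /mlift msupp0 big_nil. Qed.

Let mliftB g h : mlift (g - h) = mlift g - mlift h.
Proof. by have := mlift_linear (-1) h g; rewrite !scaleN1r ![- _ + _]addrC. Qed.

Let mliftZ a g : mlift (a *: g) = a *: mlift g.
Proof. by rewrite -[a *: g]addr0 mlift_linear mlift0 addr0. Qed.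

Let mlift_rel g : in_span (@tensor_relator F U V) g -> mlift g = 0.
Proof.
have fZl a u v : f (a *: u) v = a *: f u v.
  by rewrite (scalable_linear (f_bil.1 v)).
have fZr a u v : f u (a *: v) = a *: f u v.
  by rewrite (scalable_linear (f_bil.2 u)).
have fDl u u' v : f (u + u') v = f u v + f u' v.
  by have := f_bil.1 v 1 u u'; rewrite /= !scale1r.
have fDr u v v' : f u (v + v') = f u v + f u v'.
  by have := f_bil.2 u 1 v v'; rewrite /= !scale1r.
move=> [s [Ss ->]]; elim: s Ss => [|p s IHs] Ss; first by rewrite big_nil.
rewrite big_cons mlift_linear IHs => [|q qs]; last by apply: Ss; rewrite inE qs orbT.
rewrite addr0; suff ->: mlift p.2 = 0 by rewrite scaler0.
case: {IHs}(Ss p (mem_head _ _)) => *; rewrite !(mliftB, mliftZ, mliftU).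
- by rewrite fDl addrAC addrK subrr.
- by rewrite fDr addrAC addrK subrr.
- by rewrite fZl subrr.
- by rewrite fZr subrr.
Qed.

Let tlift_pi g : tlift f (\pi g) = mlift g.
Proof.
apply/eqP; rewrite -subr_eq0 -[tlift _ _]/(mlift _) -mliftB; apply/eqP/mlift_rel.
apply/asboolP; have /eqmodP := reprK (\pi_(tensor U V) g); exact.
Qed.

Lemma tliftE u v : tlift f (u *t v) = f u v.
Proof. by rewrite tlift_pi mliftU. Qed.

Lemma tlift_linear : linear (tlift f).
Proof.
move=> a x y; rewrite -(reprK x) -(reprK y).
by rewrite [_ *: _]tensor_scale_pi -raddfD !tlift_pi mlift_linear.
Qed.

Lemma tlift_unique (g : {linear tensor U V -> W}) :
  (forall u v, g (u *t v) = f u v) -> g =1 tlift f.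
Proof.
move=> gE x; rewrite [in LHS](tensorE x) linear_sum; apply: eq_bigr => p _.
by rewrite linearZ gE.
Qed.

End Lift.
End TensorTheory.

Section TensorMaps.
Variables (F : fieldType).

Section Map.
Variables (U U' V V' : lmodType F).

Definition tmap (f : U -> U') (g : V -> V') : tensor U V -> tensor U' V' :=
  tlift (fun u v => f u *t g v).

Lemma tmapE (f : {linear U -> U'}) (g : {linear V -> V'}) u v :
  tmap f g (u *t v) = f u *t g v.
Proof.
rewrite /tmap tliftE //; split=> [w a x y|w a x y] /=.
  by rewrite linearP tensDl tensZl.
by rewrite linearP tensDr tensZr.
Qed.

End Map.

Variable V : lmodType F.
Local Notation V2 := (tensor V V).
Local Notation V3 := (tensor (tensor V V) V).

Definition tensor_perm12 : V2 -> V2 := tlift (fun x y => y *t x).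

Lemma tensor_perm12E x y : tensor_perm12 (x *t y) = y *t x.
Proof.
rewrite /tensor_perm12 tliftE //; split=> [z a u v|z a u v] /=.
  by rewrite tensDr tensZr.
by rewrite tensDl tensZl.
Qed.

Lemma tensor_perm12_linear : linear tensor_perm12.
Proof.
apply: tlift_linear; split=> [z a u v|z a u v] /=.
  by rewrite tensDr tensZr.
by rewrite tensDl tensZl.
Qed.

(* V (x) V (x) V is associated to the left, so that t (x) c is simply t *t c  *)
(* for t in V (x) V, while b (x) t is the image of t under (x (x) y) |->      *)
(* (b (x) x) (x) y.                                                           *)
Definition tensor_consl (b : V) : V2 -> V3 := tlift (fun x y => b *t x *t y).

Fact tensor_consl_bilin b : bilinear_map (fun x y => b *t x *t y : V3).
Proof.
split=> [z a u v|z a u v] /=; last by rewrite tensDr tensZr.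
by rewrite tensDr tensZr tensDl tensZl.
Qed.

Lemma tensor_conslE b x y : tensor_consl b (x *t y) = b *t x *t y.
Proof. exact/tliftE/tensor_consl_bilin. Qed.

Definition tensor3_perm12 : V3 -> V3 := tlift (fun t z => tensor_perm12 t *t z).

Lemma tensor3_perm12E x y z : tensor3_perm12 (x *t y *t z) = y *t x *t z.
Proof.
rewrite /tensor3_perm12 tliftE ?tensor_perm12E //.
split=> [w a u v|w a u v] /=; last by rewrite tensDr tensZr.
by rewrite tensor_perm12_linear tensDl tensZl.
Qed.

Fact tensor_insert_bilin (z : V) : bilinear_map (fun x y => x *t z *t y : V3).
Proof.
split=> [w a u v|w a u v] /=; last by rewrite tensDr tensZr.
by rewrite !(tensDl, tensZl).
Qed.

Definition tensor3_perm23 : V3 -> V3 :=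
  tlift (fun t z => tlift (fun x y => x *t z *t y) t).

Fact tensor3_perm23_bilin : bilinear_map
  (fun (t : V2) (z : V) => tlift (fun x y => x *t z *t y : V3) t).
Proof.
split=> [w a u v|t a u v] /=; first exact/tlift_linear/tensor_insert_bilin.
by apply: tlift_comb => p q; rewrite tensDr tensZr tensDl tensZl.
Qed.

Lemma tensor3_perm23E x y z : tensor3_perm23 (x *t y *t z) = x *t z *t y.
Proof.
rewrite /tensor3_perm23 (tliftE tensor3_perm23_bilin).
exact/tliftE/tensor_insert_bilin.
Qed.

Lemma tensor3_perm23_linear : linear tensor3_perm23.
Proof. exact/tlift_linear/tensor3_perm23_bilin. Qed.

End TensorMaps.

Section DoubleLie.
Variables (F : fieldType) (V : lmodType F).
Variable br : {linear tensor V V -> tensor V V}.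

(* {{a, t}}_L, {{a, t}}_R and {{t, c}}_L for t in V (x) V.                    *)
Definition dbr_rL (a : V) (t : tensor V V) : tensor (tensor V V) V :=
  tlift (fun b c => br (a *t b) *t c) t.

Definition dbr_rR (a : V) (t : tensor V V) : tensor (tensor V V) V :=
  tlift (fun b c => tensor_consl b (br (a *t c))) t.

Definition dbr_lL (t : tensor V V) (c : V) : tensor (tensor V V) V :=
  tlift (fun a b => tensor3_perm23 (br (a *t c) *t b)) t.

Lemma dbr_rLE a b c : dbr_rL a (b *t c) = br (a *t b) *t c.
Proof.
rewrite /dbr_rL tliftE //; split=> [w k u v|w k u v] /=.
  by rewrite tensDr tensZr linearP tensDl tensZl.
by rewrite tensDr tensZr.
Qed.

Lemma dbr_rRE a b c : dbr_rR a (b *t c) = tensor_consl b (br (a *t c)).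
Proof.
rewrite /dbr_rR tliftE //; split=> [w k u v|w k u v] /=.
  by apply: tlift_comb => x y; rewrite !(tensDl, tensZl).
rewrite tensDr tensZr linearP; exact/tlift_linear/tensor_consl_bilin.
Qed.

Lemma dbr_lLE a b c : dbr_lL (a *t b) c = tensor3_perm23 (br (a *t c) *t b).
Proof.
apply: (@tliftE _ _ _ _ (fun a b => tensor3_perm23 (br (a *t c) *t b))).
split=> [w k u v|w k u v] /=; rewrite -tensor3_perm23_linear.
  by rewrite tensDl tensZl linearP tensDl tensZl.
by rewrite tensDr tensZr.
Qed.

(* The bracket br is given as a linear map on V (x) V: {{a, b}} = br (a *t b).*)
Definition double_lie (lam : F) : Prop :=
  (forall a b : V,
     br (a *t b) + tensor_perm12 (br (b *t a)) = lam *: (a *t b - b *t a)) /\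
  (forall a b c : V,
     dbr_rL a (br (b *t c)) - dbr_rR b (br (a *t c)) - dbr_lL (br (a *t b)) c
     = - lam *: tensor3_perm12 (tensor_consl b (br (a *t c)))).

End DoubleLie.

Section DoublePoisson.
Variables (F : fieldType) (A : algType F).

Definition tmul (s t : tensor A A) : tensor A A :=
  tlift (fun a b => tlift (fun c d => (a * c) *t (b * d)) t) s.

Lemma tmulE a b c d : tmul (a *t b) (c *t d) = (a * c) *t (b * d).
Proof.
have bil x y : bilinear_map (fun u v => (x * u) *t (y * v) : tensor A A).
  split=> [w k u v|w k u v] /=.
    by rewrite mulrDr -scalerAr tensDl tensZl.
  by rewrite mulrDr -scalerAr tensDr tensZr.
rewrite /tmul tliftE ?tliftE //; split=> [w k u v|w k u v] /=.
  by apply: tlift_comb => x y; rewrite mulrDl -scalerAl tensDl tensZl.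
by apply: tlift_comb => x y; rewrite mulrDl -scalerAl tensDr tensZr.
Qed.

Definition tensor_mu : tensor A A -> A := tlift (fun a b => a * b).

Lemma tensor_muE a b : tensor_mu (a *t b) = a * b.
Proof.
rewrite /tensor_mu tliftE //; split=> [w k u v|w k u v] /=.
  by rewrite mulrDl -scalerAl.
by rewrite mulrDr -scalerAr.
Qed.

Definition commutator_span : A -> Prop :=
  in_span (fun z => exists x y : A, z = x * y - y * x).

Variable br : {linear tensor A A -> tensor A A}.

Definition derivation_right : Prop := forall a b c : A,
  br (a *t (b * c)) = tmul (b *t 1) (br (a *t c)) + tmul (br (a *t b)) (1 *t c).

Definition derivation_left : Prop := forall a b c : A,
  br ((a * b) *t c) = tmul (1 *t a) (br (b *t c)) + tmul (br (a *t c)) (b *t 1).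

Definition mu_br (a b : A) : A := tensor_mu (br (a *t b)).

Definition modified_double_poisson : Prop :=
  [/\ derivation_right,
      derivation_left,
      forall a b c : A,
        mu_br a (mu_br b c) - mu_br b (mu_br a c) = mu_br (mu_br a b) c
    & forall a b : A, commutator_span (mu_br a b + mu_br b a)].

End DoublePoisson.

Section FreeAlgebra.
Variables (F : fieldType) (n : nat).

(* The unital free associative algebra, as the algebra of the free monoid.    *)
Definition free_algebra := {malg F[{fmonom 'I_n}]}.

HB.instance Definition _ := GRing.Lalgebra.on free_algebra.

Fact free_algebra_scalerAr (a : F) (x y : free_algebra) :
  a *: (x * y) = x * (a *: y).
Proof.
apply/malgP => k; rewrite mcoeffZ !mcoeffMl mulr_sumr.
apply/esym; have [->|a0] := eqVneq a 0.
  rewrite scale0r; apply: eq_bigr => i _; rewrite mul0r msupp0.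
  by rewrite big_seq_fset0.
have supp : msupp (a *: y) = msupp y.
  by apply/fsetP => i; rewrite -!mcoeff_neq0 mcoeffZ mulf_eq0 negb_or a0.
rewrite supp; apply: eq_bigr => i _; rewrite mulr_sumr; apply: eq_bigr => j _.
by rewrite mcoeffZ mulrCA mulrnAr.
Qed.

HB.instance Definition _ :=
  GRing.Lalgebra_isAlgebra.Build F free_algebra free_algebra_scalerAr.

Definition free_gen (i : 'I_n) : free_algebra := << fmu i >>.

End FreeAlgebra.

Section Extension.
Variables (F : fieldType) (V : vectType F) (n : nat) (e : n.-tuple V).

(* The embedding V -> As<e_1, ..., e_n> sending e_i to the i-th generator,    *)
(* when e is a basis of V.                                                    *)
Definition basis_embed (v : V) : free_algebra F n :=
  \sum_(i < n) coord e i v *: free_gen F i.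

Fact basis_embed_linear : linear basis_embed.
Proof.
move=> a u v; rewrite /basis_embed scaler_sumr -big_split.
by apply: eq_bigr => i _; rewrite linearP /= scalerDl scalerA.
Qed.

HB.instance Definition _ :=
  GRing.isLinear.Build F V (free_algebra F n) *:%R basis_embed
    basis_embed_linear.

Lemma basis_embed_gen (i : 'I_n) : basis_of fullv e -> basis_embed e`_i = free_gen F i.
Proof.
move=> /basis_free e_free; rewrite /basis_embed (bigD1 i) //= coord_free //.
rewrite eqxx scale1r big1 ?addr0 // => j /negPf ij.
by rewrite coord_free // eq_sym ij scale0r.
Qed.

Definition extends_bracket (br : {linear tensor V V -> tensor V V})
    (Br : {linear tensor (free_algebra F n) (free_algebra F n)
           -> tensor (free_algebra F n) (free_algebra F n)}) : Prop :=
  forall u v : V, Br (basis_embed u *t basis_embed v)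
                  = tmap basis_embed basis_embed (br (u *t v)).

End Extension.

(* Main.v *)
(* For x in A write B x a b for the sum of p x q over the terms p (x) q of    *)
(* {{a, b}}, so that {a, b} = B 1 a b. The derivation rules of the double     *)
(* bracket become                                                             *)
(*   B x a (b c) = b (B x a c) + (B x a b) c,                                 *)
(*   B x (a b) c = B (x a) b c + B (b x) a c.                                 *)
(* Take the expression                                                        *)
(*   J x y a b c = B x a (B y b c) - B y b (B x a c) - B (B x a y) b c        *)
(*     - B y (B x a b) c - B (B y b a) x c + B (B y b x) a c,                 *)
(* which is the defect of the Jacobi identity when x = y = 1. The last two    *)
(* terms are chosen so that J obeys the cyclic rule                           *)
(*   Q (u v) x = Q v (x u) + Q u (v x)                                        *)
(* both in (a, x) and in (b, y). On generators the axioms of a lambda-double  *)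
(* Lie algebra give                                                           *)
(*   J x y a b c = lambda (B (y b) (x a) c - B (b y) (a x) c).                *)
(* The cyclic rule then turns x a into the sum of all rotations of the word a *)
(* when x = 1, and a x into the same sum; the same happens with y b and b y,  *)
(* so the two terms cancel. The symmetric part B x a b y + B y b a x obeys    *)
(* the same rule modulo commutators, which gives {a, b} + {b, a} in [A, A].   *)

Require Import Defs.
From mathcomp Require Import all_boot all_order all_algebra.
From HB Require Import structures.
From mathcomp Require Import finmap monalg.

Set Implicit Arguments.
Unset Strict Implicit.
Unset Printing Implicit Defensive.

Import GRing.Theory.
Local Open Scope ring_scope.

(** The proof has two halves. For the identities, [bracket_inserted] trades the double bracket for a
    ternary operation with values in A, so that no tensor is left. There [jac_iota] and [skew_iota]
    evaluate the Jacobi defect and the symmetric part on V: each is lambda times a difference of two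
    terms that rotation makes equal. [rotation_sum] carries this from V to words, once in a and once
    in b, and gives [ins_jacobi] and [ins_skew].

    For existence and uniqueness, a double bracket is a derivation into A (x) A in each argument:
    for the outer bimodule structure in the second one, for the inner structure in the first. A
    derivation of a free algebra is freely determined by its values on generators. As the two
    structures commute, the arguments can be extended one after the other ([double_bracket_exists]);
    [double_bracket_unique] compares two brackets in the same way. *)

Lemma eq_of_subr0 (M : zmodType) (x y : M) : x - y + 0 = 0 -> x = y.
Proof. by rewrite addr0 => /eqP; rewrite subr_eq0 => /eqP. Qed.

(* Decides equations between sums of signed atoms in an abelian group, up to  *)
(* associativity, commutativity and cancellation.                             *)
Ltac abel_cancel x :=
  match goal with
  | |- context [x + (- x + _)] => rewrite (addNKr x)
  | |- context [x + (?y + ?R)] => rewrite (addrCA x y R); abel_cancel x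
  | |- _ => rewrite (addNKr x)
  end.
Ltac abel_cancelN x :=
  match goal with
  | |- context [- x + (x + _)] => rewrite (addKr x)
  | |- context [- x + (?y + ?R)] => rewrite (addrCA (- x) y R); abel_cancelN x
  | |- _ => rewrite (addKr x)
  end.
Ltac abel :=
  rewrite ?(addr0, add0r, oppr0);
  apply: eq_of_subr0;
  rewrite ?(opprD, opprK) -?addrA;
  repeat match goal with
  | |- 0 = 0 => reflexivity
  | |- - ?x + _ = 0 => abel_cancelN x
  | |- ?x + _ = 0 => abel_cancel x
  end.

(** * Linear maps and induction on tensors *)

Section LinearMaps.
Variables (F : fieldType) (U W : lmodType F).

Lemma lin_add (f : U -> W) : linear f -> {morph f : x y / x + y}.
Proof. by move=> f_lin x y; have := f_lin 1 x y; rewrite !scale1r. Qed.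

Lemma lin_0 (f : U -> W) : linear f -> f 0 = 0.
Proof. by move=> f_lin; apply: (addIr (f 0)); rewrite -lin_add // !add0r. Qed.

Lemma lin_scale (f : U -> W) k u : linear f -> f (k *: u) = k *: f u.
Proof. by move=> f_lin; have := f_lin k u 0; rewrite (lin_0 f_lin) !addr0. Qed.

Lemma lin_opp (f : U -> W) u : linear f -> f (- u) = - f u.
Proof. by move=> f_lin; rewrite -scaleN1r lin_scale // scaleN1r. Qed.

Lemma lin_affine (f : U -> W) k u v w :
  linear f -> f (k *: (u - v) - w) = k *: (f u - f v) - f w.
Proof.
by move=> fl; rewrite !(lin_add fl) !(lin_opp _ fl) lin_scale // lin_add // lin_opp.
Qed.

Lemma linear_add (f g : U -> W) :
  linear f -> linear g -> linear (fun u => f u + g u).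
Proof. by move=> fl gl k u v; rewrite fl gl scalerDr addrACA. Qed.

End LinearMaps.

Lemma linear_comp (F : fieldType) (U V W : lmodType F) (f : V -> W) (g : U -> V) :
  linear f -> linear g -> linear (fun u => f (g u)).
Proof. by move=> fl gl k u v; rewrite gl fl. Qed.


Section TensorInduction.
Variables (F : fieldType) (U V : lmodType F).

Lemma tens0l (v : V) : (0 : U) *t v = 0.
Proof. by rewrite -[X in X *t _](scale0r 0) tensZl scale0r. Qed.

(** Closure under sums is enough: a scalar is absorbed into the left factor, and zero is the pure
    tensor of two zeros. *)
Lemma tensor_ind (P : tensor U V -> Prop) :
    (forall u v, P (u *t v)) -> (forall s t, P s -> P t -> P (s + t)) ->
  forall t, P t.
Proof.
move=> P1 PD t; rewrite (tensorE t).
elim: (enum_fset _) => [|p s IHs]; first by rewrite big_nil -(tens0l 0).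
by rewrite big_cons -tensZl; apply: PD.
Qed.

Lemma tensor_lin_ext (W : lmodType F) (f g : tensor U V -> W) : linear f -> linear g ->
  (forall u v, f (u *t v) = g (u *t v)) -> f =1 g.
Proof.
move=> f_lin g_lin fg; elim/tensor_ind=> // s t IHs IHt.
by rewrite (lin_add f_lin) (lin_add g_lin) IHs IHt.
Qed.

End TensorInduction.

(** * Inserting an element between the two tensor factors *)

Section Sandwich.
Variables (F : fieldType) (A : algType F).

Definition sandwich (x : A) : tensor A A -> A := tlift (fun p q => p * x * q).

Fact sandwich_bilin x : bilinear_map (fun p q : A => p * x * q).
Proof.
split=> [w a u v|w a u v] /=; first by rewrite !mulrDl -!scalerAl.
by rewrite mulrDr -!scalerAr.
Qed.

Lemma sandwich_linear x : linear (sandwich x).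
Proof. exact/tlift_linear/sandwich_bilin. Qed.

Lemma sandwichE x p q : sandwich x (p *t q) = p * x * q.
Proof. exact: tliftE (sandwich_bilin x) _ _. Qed.

Lemma sandwichD x s t : sandwich x (s + t) = sandwich x s + sandwich x t.
Proof. exact: (lin_add (sandwich_linear x)). Qed.

Lemma sandwich_linearl t : linear (sandwich^~ t).
Proof.
by move=> a x y; apply: tlift_comb => p q; rewrite mulrDr mulrDl -scalerAr -scalerAl.
Qed.

End Sandwich.

Section TensorSquare.
Variables (F : fieldType) (A : algType F).

Lemma tmul_linearl (t : tensor A A) : linear (fun s => tmul s t).
Proof.
apply: tlift_linear; split=> [w k u v|w k u v] /=.
  by apply: tlift_comb => x y; rewrite mulrDl -scalerAl tensDl tensZl.
by apply: tlift_comb => x y; rewrite mulrDl -scalerAl tensDr tensZr.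
Qed.

Lemma tmul_linearr (s : tensor A A) : linear (@tmul F A s).
Proof.
move=> k t u; apply: tlift_comb => x y; apply: tlift_linear.
split=> [w l v v'|w l v v'] /=; last by rewrite mulrDr -scalerAr tensDr tensZr.
by rewrite mulrDr -scalerAr tensDl tensZl.
Qed.

Lemma tmulDl s s' t : tmul (s + s') t = tmul s t + tmul s' t :> tensor A A.
Proof. by have := tmul_linearl t 1 s s'; rewrite !scale1r. Qed.

Lemma tmulDr s t t' : tmul s (t + t') = tmul s t + tmul s t' :> tensor A A.
Proof. by have := tmul_linearr s 1 t t'; rewrite !scale1r. Qed.

Lemma sandwich_tmull (x b c : A) (t : tensor A A) :
  sandwich x (tmul (b *t c) t) = b * sandwich (x * c) t.
Proof.
elim/tensor_ind: t => [p q|s t IHs IHt]; first by rewrite tmulE !sandwichE !mulrA.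
by rewrite tmulDr [LHS]sandwichD [in RHS]sandwichD mulrDr -IHs -IHt.
Qed.

Lemma sandwich_tmulr (x b c : A) (t : tensor A A) :
  sandwich x (tmul t (b *t c)) = sandwich (b * x) t * c.
Proof.
elim/tensor_ind: t => [p q|s t IHs IHt]; first by rewrite tmulE !sandwichE !mulrA.
by rewrite tmulDl [LHS]sandwichD [in RHS]sandwichD mulrDl -IHs -IHt.
Qed.

(** Outer factors stay outside the inserted element, while the inner ones of [sandwich_inner] are
    absorbed into it; hence the different shapes of [insM3] and [insM2]. *)
Lemma sandwich_outer (x b c : A) (s t : tensor A A) :
  sandwich x (tmul (b *t 1) s + tmul t (1 *t c)) = b * sandwich x s + sandwich x t * c.
Proof.
rewrite sandwichD; congr (_ + _); first by have := sandwich_tmull x b 1 s; rewrite mulr1.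
by have := sandwich_tmulr x 1 c t; rewrite mul1r.
Qed.

Lemma sandwich_inner (x a b : A) (s t : tensor A A) :
  sandwich x (tmul (1 *t a) s + tmul t (b *t 1))
  = sandwich (x * a) s + sandwich (b * x) t.
Proof.
rewrite sandwichD; congr (_ + _); first by have := sandwich_tmull x 1 a s; rewrite mul1r.
by have := sandwich_tmulr x b 1 t; rewrite mulr1.
Qed.

Lemma tmul11l (t : tensor A A) : tmul (1 *t 1) t = t.
Proof.
elim/tensor_ind: t => [p q|s t IHs IHt]; first by rewrite tmulE !mul1r.
by rewrite tmulDr IHs IHt.
Qed.

Lemma tmul11r (t : tensor A A) : tmul t (1 *t 1) = t.
Proof.
elim/tensor_ind: t => [p q|s t IHs IHt]; first by rewrite tmulE !mulr1.
by rewrite tmulDl IHs IHt.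
Qed.

End TensorSquare.

(** * Brackets with an inserted element and their Jacobi defect *)

Section InsertedBracket.
Variables (F : fieldType) (A : algType F) (B : A -> A -> A -> A).

Record inserted_bracket : Prop := InsertedBracket {
  ins_linear1 : forall a b, linear (fun x => B x a b);
  ins_linear2 : forall x b, linear (fun a => B x a b);
  ins_linear3 : forall x a, linear (B x a);
  insM2 : forall x a b c, B x (a * b) c = B (x * a) b c + B (b * x) a c;
  insM3 : forall x a b c, B x a (b * c) = b * B x a c + B x a b * c
}.

Hypothesis B_ins : inserted_bracket.

Lemma insD1 x y a b : B (x + y) a b = B x a b + B y a b.
Proof. exact: (lin_add (ins_linear1 B_ins a b)). Qed.

Lemma ins01 a b : B 0 a b = 0.
Proof. exact: (lin_0 (ins_linear1 B_ins a b)). Qed.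

Lemma insZ1 k x a b : B (k *: x) a b = k *: B x a b.
Proof. exact: (lin_scale k x (ins_linear1 B_ins a b)). Qed.

Lemma insN1 x a b : B (- x) a b = - B x a b.
Proof. exact: (lin_opp x (ins_linear1 B_ins a b)). Qed.

Lemma insD2 x a a' b : B x (a + a') b = B x a b + B x a' b.
Proof. exact: (lin_add (ins_linear2 B_ins x b)). Qed.

Lemma insZ2 k x a b : B x (k *: a) b = k *: B x a b.
Proof. exact: (lin_scale k a (ins_linear2 B_ins x b)). Qed.

Lemma insD3 x a b c : B x a (b + c) = B x a b + B x a c.
Proof. exact: (lin_add (ins_linear3 B_ins x a)). Qed.

Lemma ins03 x a : B x a 0 = 0.
Proof. exact: (lin_0 (ins_linear3 B_ins x a)). Qed.

Lemma insZ3 k x a b : B x a (k *: b) = k *: B x a b.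
Proof. exact: (lin_scale k b (ins_linear3 B_ins x a)). Qed.

Lemma ins13 x a : B x a 1 = 0.
Proof.
by apply: (addIr (B x a 1)); have := insM3 B_ins x a 1 1; rewrite !mulr1 mul1r add0r.
Qed.

Lemma ins12 x c : B x 1 c = 0.
Proof.
by apply: (addIr (B x 1 c)); have := insM2 B_ins x 1 1 c; rewrite !mulr1 mul1r add0r.
Qed.

(* The last two terms, which vanish for x = y = 1, make jac obey jacMa and    *)
(* jacMb.                                                                     *)
Definition jac x y a b c :=
  B x a (B y b c) - B y b (B x a c) - B (B x a y) b c - B y (B x a b) c
  - B (B y b a) x c + B (B y b x) a c.

Let expand := (insM3 B_ins, insM2 B_ins, insD1, insD2, insD3,
  (@mulrDl A), (@mulrDr A), (@mulrA A)).

Lemma jacMa x y a a' b c :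
  jac x y (a * a') b c = jac (x * a) y a' b c + jac (a' * x) y a b c.
Proof. by rewrite /jac !expand; abel. Qed.

Lemma jacMb x y a b b' c :
  jac x y a (b * b') c = jac x (y * b) a b' c + jac x (b' * y) a b c.
Proof. by rewrite /jac !expand; abel. Qed.

End InsertedBracket.

(** * Rotation of words *)

Section Rotation.
Variables (F : fieldType) (A : algType F) (I : Type) (gen : I -> A).

(** Stated as an induction principle: the words in the generators span A. *)
Definition generated_by : Prop := forall P : A -> Prop,
    P 1 -> (forall x y, P x -> P y -> P (x + y)) ->
    (forall k x, P x -> P (k *: x)) -> (forall i x, P x -> P (gen i * x)) ->
  forall x, P x.

Hypothesis A_gen : generated_by.

(* For a = a_1 ... a_k, iterating the rule gives                              *)
(* Q a x = \sum_i Q a_i (a_(i+1) ... a_k x a_1 ... a_(i-1)), and r is the sum *)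
(* of all a_(i+1) ... a_k x a_1 ... a_i.                                      *)
Lemma rotation_sum (S : A -> Prop) a x : exists r,
  forall (Q : A -> A -> A) (f g : A -> A),
    (forall x, linear (Q^~ x)) -> linear f -> linear g ->
    (forall u v x, in_span S (Q (u * v) x - (Q v (x * u) + Q u (v * x)))) ->
    (forall i x, in_span S (Q (gen i) x - (f (x * gen i) - g (gen i * x)))) ->
  in_span S (Q a x - (f r - g (r + a * x - x * a))).
Proof.
elim/A_gen: a x => [x|a b IHa IHb x|k a IHa x|i a IHa x].
- exists 0 => Q f g Qlin flin glin QM Qgen.
  rewrite mul1r mulr1 add0r subrr (lin_0 flin) (lin_0 glin) !subr0.
  (* For u = v = 1 the rule reads Q 1 x = 2 Q 1 x modulo the span, so Q 1 x lies in the span. *)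
  have := QM 1 1 x; rewrite !(mul1r, mulr1) => /(in_spanZ (-1)).
  by rewrite scaleN1r opprD opprK addKr.
- have [r Hr] := IHa x; have [s Hs] := IHb x.
  exists (r + s) => Q f g Qlin flin glin QM Qgen.
  have Ha := Hr Q f g Qlin flin glin QM Qgen.
  have := in_spanD Ha (Hs Q f g Qlin flin glin QM Qgen).
  congr in_span.
  rewrite (lin_add (Qlin x)) mulrDl mulrDr !opprD !addrA.
  by rewrite !(lin_add flin) !(lin_add glin) !(lin_opp _ glin); abel.
- have [r Hr] := IHa x.
  exists (k *: r) => Q f g Qlin flin glin QM Qgen.
  have := in_spanZ k (Hr Q f g Qlin flin glin QM Qgen).
  rewrite (lin_scale _ _ (Qlin x)) -scalerAl -scalerAr -scalerDr -scalerBr.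
  by rewrite (lin_scale _ _ flin) (lin_scale _ _ glin) -!scalerBr.
have [r Hr] := IHa (x * gen i).
(* The cyclic rule gives Q a (x * gen i), handled by r, and Q (gen i) (a * x), which contributes f
   (a * x * gen i) - g (gen i * a * x). *)
exists (r + a * x * gen i) => Q f g Qlin flin glin QM Qgen.
have H1 := Hr Q f g Qlin flin glin QM Qgen.
have := in_spanD (QM (gen i) a x) (in_spanD H1 (Qgen i (a * x))).
congr in_span; rewrite !mulrA !(lin_add flin) !(lin_add glin) !(lin_opp _ glin).
abel.
Qed.

Variable B : A -> A -> A -> A.
Hypothesis B_ins : inserted_bracket B.
Variable lam : F.

Hypothesis jac_gen : forall x y i j k,
  jac B x y (gen i) (gen j) (gen k)
  = lam *: (B (y * gen j) (x * gen i) (gen k) - B (gen j * y) (gen i * x) (gen k)).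

Hypothesis skew_gen : forall x y i j,
  commutator_span (B x (gen i) (gen j) * y + B y (gen j) (gen i) * x
    - lam *: (gen j * y * (gen i * x) - y * gen j * (x * gen i))).

Let linB := (insD1 B_ins, insD2 B_ins, insD3 B_ins, insZ1 B_ins, insZ2 B_ins, insZ3 B_ins).

(** With the empty spanning set, [rotation_sum] is about equalities in A. *)
Lemma in_span_False (x : A) : in_span (fun=> False) x -> x = 0.
Proof.
move=> [[|p s] [Ss ->]]; first by rewrite big_nil.
by have := Ss p (mem_head _ _).
Qed.

(** Rotating a replaces both x * gen i and gen i * x by r. What remains is a difference in y * gen j
    and gen j * y, and rotating b replaces both of these by s. *)
Lemma jac11_gen a b k : jac B 1 1 a b (gen k) = 0.
Proof.
(* r is chosen before Q, f and g, so that one r serves all y and j. For x = 1 the correction a * x -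
   x * a vanishes. *)
have [r Hr] := rotation_sum (fun=> False) a 1.
have [s Hs] := rotation_sum (fun=> False) b 1.
have jac1 y j : jac B 1 y a (gen j) (gen k)
    = lam *: B (y * gen j) r (gen k) - lam *: B (gen j * y) r (gen k).
  apply/eqP; rewrite -subr_eq0; apply/eqP/in_span_False.
  have := Hr (fun a x => jac B x y a (gen j) (gen k))
    (fun z => lam *: B (y * gen j) z (gen k)) (fun z => lam *: B (gen j * y) z (gen k)).
  rewrite mulr1 mul1r addrK; apply.
  - by move=> x l u v; rewrite /jac !linB !(scalerDr, scalerN); abel.
  - by move=> l u v; rewrite !linB scalerDr !scalerA mulrC.
  - by move=> l u v; rewrite !linB scalerDr !scalerA mulrC.
  - by move=> u v x; rewrite (jacMa B_ins) subrr; apply: in_span0.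
  - by move=> i x; rewrite jac_gen -scalerBr subrr; apply: in_span0.
apply: in_span_False.
have := Hs (fun b y => jac B 1 y a b (gen k))
  (fun z => lam *: B z r (gen k)) (fun z => lam *: B z r (gen k)).
rewrite mulr1 mul1r addrK subrr subr0; apply.
- by move=> x l u v; rewrite /jac !linB !(scalerDr, scalerN); abel.
- by move=> l u v; rewrite !linB scalerDr !scalerA mulrC.
- by move=> l u v; rewrite !linB scalerDr !scalerA mulrC.
- by move=> u v x; rewrite (jacMb B_ins) subrr; apply: in_span0.
- by move=> j y; rewrite jac1 subrr; apply: in_span0.
Qed.

(** The defect of a commutator of derivations from a derivation is again a derivation in c, so it
    vanishes once it vanishes on generators. *)
Lemma ins_jacobi a b c : B 1 a (B 1 b c) - B 1 b (B 1 a c) = B 1 (B 1 a b) c.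
Proof.
elim/A_gen: c => [|c d IHc IHd|l c IHc|k c IHc].
- by rewrite !(ins13 B_ins, ins03 B_ins) subrr.
- by rewrite !linB -IHc -IHd; abel.
- by rewrite !linB -IHc scalerBr.
(* At x = y = 1 the other three terms of [jac] contain a bracket with an argument 1 and vanish. *)
have := jac11_gen a b k.
rewrite /jac !(ins13 B_ins, ins12 B_ins, ins01 B_ins) !(subr0, addr0) => /eqP.
rewrite subr_eq0 => /eqP IHk.
by rewrite !(insM3 B_ins, linB) -IHc -IHk mulrBr mulrBl; abel.
Qed.

Lemma commutator_spanE (x y : A) : commutator_span (x * y - y * x).
Proof. by apply: in_span_gen; exists x, y. Qed.

(** The double rotation of [jac11_gen], now modulo commutators: rotating a leaves lambda times gen j
    * y * r - y * gen j * r, and rotating b turns both terms into s * r. *)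
Lemma ins_skew a b : commutator_span (B 1 a b + B 1 b a).
Proof.
pose S (z : A) := exists x y : A, z = x * y - y * x.
have [r Hr] := rotation_sum S a 1; have [s Hs] := rotation_sum S b 1.
have skew1 y j : in_span S (B 1 a (gen j) * y + B y (gen j) a
    - (lam *: (- (y * gen j * r)) - lam *: (- (gen j * y * r)))).
  have := Hr (fun a x => B x a (gen j) * y + B y (gen j) a * x)
    (fun z => lam *: (- (y * gen j * z))) (fun z => lam *: (- (gen j * y * z))).
  rewrite !mulr1 mul1r addrK; apply.
  - by move=> x l u v; rewrite !linB !mulrDl -!scalerAl !scalerDr; abel.
  - move=> l u v; rewrite mulrDr -scalerAr opprD scalerDr -!scalerN !scalerA.
    by rewrite (mulrC l).
  - move=> l u v; rewrite mulrDr -scalerAr opprD scalerDr -!scalerN !scalerA.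
    by rewrite (mulrC l).
  - move=> u v x; have := commutator_spanE u (B y (gen j) v * x); congr in_span.
    by rewrite (insM2 B_ins) (insM3 B_ins) !(mulrDl, mulrA); abel.
  - move=> i x; have := skew_gen x y i j; congr in_span.
    by rewrite scalerBr !scalerN; abel.
have := Hs (fun b y => B 1 a b * y + B y b a)
  (fun z => lam *: (- (z * r))) (fun z => lam *: (- (z * r))).
rewrite !mulr1 mul1r addrK subrr subr0; apply.
- by move=> x l u v; rewrite !linB !mulrDl -!scalerAl !scalerDr; abel.
- by move=> l u v; rewrite mulrDl -scalerAl opprD scalerDr -!scalerN !scalerA (mulrC l).
- by move=> l u v; rewrite mulrDl -scalerAl opprD scalerDr -!scalerN !scalerA (mulrC l).
- move=> u v x; have := commutator_spanE u (B 1 a v * x); congr in_span.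
  by rewrite (insM2 B_ins) (insM3 B_ins) !(mulrDl, mulrA); abel.
- by move=> j y; apply: skew1.
Qed.

End Rotation.

(** * The double Lie axioms evaluated on generators *)

Section DoubleLieLinear.
Variables (F : fieldType) (V : lmodType F) (br : {linear tensor V V -> tensor V V}).

Lemma tensor_consl_linear (b : V) : linear (tensor_consl b).
Proof. exact/tlift_linear/tensor_consl_bilin. Qed.

Lemma dbr_rL_linear a : linear (dbr_rL br a).
Proof.
apply: tlift_linear; split=> [w k u v|w k u v] /=.
  by rewrite tensDr tensZr linearP tensDl tensZl.
by rewrite tensDr tensZr.
Qed.

Lemma dbr_rR_linear a : linear (dbr_rR br a).
Proof.
apply: tlift_linear; split=> [w k u v|w k u v] /=.
  by apply: tlift_comb => x y; rewrite !(tensDl, tensZl).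
by rewrite tensDr tensZr linearP tensor_consl_linear.
Qed.

Lemma dbr_lL_linear c : linear (fun t => dbr_lL br t c).
Proof.
apply: (@tlift_linear _ _ _ _ (fun a b => tensor3_perm23 (br (a *t c) *t b))).
split=> [w k u v|w k u v] /=; rewrite -tensor3_perm23_linear.
  by rewrite tensDl tensZl linearP tensDl tensZl.
by rewrite tensDr tensZr.
Qed.

Lemma tensor3_perm12_linear : linear (@tensor3_perm12 F V).
Proof.
apply: tlift_linear; split=> [w k u v|w k u v] /=.
  by rewrite tensor_perm12_linear tensDl tensZl.
by rewrite tensDr tensZr.
Qed.

End DoubleLieLinear.

Section GeneratorFormulas.
Variables (F : fieldType) (V : lmodType F) (A : algType F).
Variables (br : {linear tensor V V -> tensor V V}) (lam : F).
Variables (iota : V -> A) (B : A -> A -> A -> A).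
Variables (sw : A -> tensor V V -> A) (sw3 : A -> A -> tensor (tensor V V) V -> A).

Hypothesis br_lie : double_lie br lam.
Hypothesis B_ins : inserted_bracket B.
Hypothesis sw_linear : forall x, linear (sw x).
Hypothesis swE : forall x p q, sw x (p *t q) = iota p * x * iota q.
Hypothesis sw3_linear : forall x y, linear (sw3 x y).
Hypothesis sw3E : forall x y t r, sw3 x y (t *t r) = sw x t * y * iota r.
Hypothesis B_br : forall x u v, B x (iota u) (iota v) = sw x (br (u *t v)).

Let linB := (insD1 B_ins, insD2 B_ins, insD3 B_ins, insZ1 B_ins, insZ2 B_ins, insZ3 B_ins).

Lemma sw3_consl x y b t : sw3 x y (tensor_consl b t) = iota b * x * sw y t.
Proof.
move: t; apply: tensor_lin_ext => [k s t|k s t|p q].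
- by rewrite (tensor_consl_linear b k s t) sw3_linear.
- by rewrite sw_linear mulrDr -scalerAr.
by rewrite tensor_conslE sw3E !swE !mulrA.
Qed.

Lemma sw3_perm23 x y b t : sw3 x y (tensor3_perm23 (t *t b)) = sw (x * iota b * y) t.
Proof.
move: t; apply: tensor_lin_ext => [k s t|k s t|p q].
- by rewrite tensDl tensZl tensor3_perm23_linear sw3_linear.
- exact: sw_linear.
by rewrite tensor3_perm23E sw3E !swE !mulrA.
Qed.

Lemma sw3_perm12_consl x y b t :
  sw3 x y (tensor3_perm12 (tensor_consl b t)) = sw (x * iota b * y) t.
Proof.
move: t; apply: tensor_lin_ext => [k s t|k s t|p q].
- by rewrite (tensor_consl_linear b k s t) tensor3_perm12_linear sw3_linear.
- exact: sw_linear.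
by rewrite tensor_conslE tensor3_perm12E sw3E !swE !mulrA.
Qed.

(** For t = p (x) q this is the Leibniz rule on p y q: the bracket with u falls on p, on y or on
    q. *)
Lemma ins_sw_right x y u t : B x (iota u) (sw y t)
  = sw3 x y (dbr_rL br u t) + sw (B x (iota u) y) t + sw3 y x (dbr_rR br u t).
Proof.
move: t; apply: tensor_lin_ext => [k s t|k s t|p q].
- by rewrite sw_linear !linB.
- have L1 := linear_comp (sw3_linear x y) (dbr_rL_linear br u).
  have L3 := linear_comp (sw3_linear y x) (dbr_rR_linear br u).
  exact: (linear_add (linear_add L1 (sw_linear _)) L3).
rewrite dbr_rLE dbr_rRE sw3E sw3_consl !swE -!B_br !(insM3 B_ins).
by rewrite !(mulrDl, mulrDr, mulrA); abel.
Qed.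

(** For t = p (x) q the cyclic rule brackets w with each of q, x and p in turn, the other two being
    rotated around y. *)
Lemma ins_sw_left x y w t : B y (sw x t) (iota w)
  = sw3 y x (dbr_lL br (tensor_perm12 t) w) + B (sw y (tensor_perm12 t)) x (iota w)
    + sw3 x y (dbr_lL br t w).
Proof.
move: t; apply: tensor_lin_ext => [k s t|k s t|p q].
- by rewrite sw_linear !linB.
- have perm_lin := @tensor_perm12_linear F V.
  have L1 := linear_comp (sw3_linear y x) (linear_comp (dbr_lL_linear br w) perm_lin).
  have L2 := linear_comp (ins_linear1 B_ins x (iota w)) (linear_comp (sw_linear y) perm_lin).
  have L3 := linear_comp (sw3_linear x y) (dbr_lL_linear br w).
  exact: (linear_add (linear_add L1 L2) L3).
rewrite tensor_perm12E !dbr_lLE !sw3_perm23 !swE -!B_br !(insM2 B_ins).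
by rewrite !mulrA; abel.
Qed.

Lemma tensor_perm12_br u v :
  tensor_perm12 (br (u *t v)) = lam *: (v *t u - u *t v) - br (v *t u).
Proof. by rewrite -(br_lie.1 v u) addrC addKr. Qed.

Lemma sw3_br x y a b c : sw3 x y (dbr_rL br a (br (b *t c)))
    - sw3 x y (dbr_rR br b (br (a *t c))) - sw3 x y (dbr_lL br (br (a *t b)) c)
  = - lam *: B (x * iota b * y) (iota a) (iota c).
Proof.
have L := sw3_linear x y.
have E t1 t2 t3 : sw3 x y (t1 - t2 - t3) = sw3 x y t1 - sw3 x y t2 - sw3 x y t3.
  by rewrite (lin_add L) (lin_add L) !(lin_opp _ L).
rewrite -E; apply: (etrans (congr1 (sw3 x y) (br_lie.2 a b c))).
by rewrite (lin_scale _ _ L) sw3_perm12_consl B_br.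
Qed.

(** The double Jacobi identity is used for (u, v, w) with insertions x, y and subtracted for (v, u,
    w) with insertions y, x. Skew-symmetry turns the flipped bracket of u, v into that of v, u
    ([P2], [P3]). The terms with a nested insertion cancel against the corrections in [jac], and
    only multiples of lambda survive. *)
Lemma jac_iota x y u v w : jac B x y (iota u) (iota v) (iota w)
  = lam *: (B (y * iota v) (x * iota u) (iota w) - B (iota v * y) (iota u * x) (iota w)).
Proof.
have E1 := sw3_br x y u v w; have E2 := sw3_br y x v u w.
have R1 := ins_sw_right x y u (br (v *t w)); rewrite -!B_br in R1.
have R2 := ins_sw_right y x v (br (u *t w)); rewrite -!B_br in R2.
have R3 := ins_sw_left x y w (br (u *t v)); rewrite -(B_br x u v) in R3.
have Lsw := sw_linear y.
have Ll := linear_comp (sw3_linear y x) (dbr_lL_linear br w).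
have lLE a b : sw3 y x (dbr_lL br (a *t b) w) = B (y * iota b * x) (iota a) (iota w).
  by rewrite dbr_lLE sw3_perm23 B_br.
have P2 : sw y (tensor_perm12 (br (u *t v)))
    = lam *: (iota v * y * iota u - iota u * y * iota v) - B y (iota v) (iota u).
  by rewrite tensor_perm12_br (lin_affine _ _ _ _ Lsw) !swE B_br.
have P3 : sw3 y x (dbr_lL br (tensor_perm12 (br (u *t v))) w)
    = lam *: (B (y * iota u * x) (iota v) (iota w) - B (y * iota v * x) (iota u) (iota w))
      - sw3 y x (dbr_lL br (br (v *t u)) w).
  rewrite tensor_perm12_br -(lLE v u) -(lLE u v).
  exact: (lin_affine lam (v *t u) (u *t v) (br (v *t u)) Ll).
rewrite P2 P3 in R3.
rewrite /jac R1 R2 R3 {R1 R2 R3 P2 P3}.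
move: E1 E2.
(* Generalizing keeps later rewrites from unfolding these terms. *)
generalize (sw3 x y (dbr_rL br u (br (v *t w)))) => l1.
generalize (sw3 y x (dbr_rL br v (br (u *t w)))) => l2.
generalize (sw3 x y (dbr_rR br v (br (u *t w)))) => r1.
generalize (sw3 y x (dbr_rR br u (br (v *t w)))) => r2.
generalize (sw3 x y (dbr_lL br (br (u *t v)) w)) => m1.
generalize (sw3 y x (dbr_lL br (br (v *t u)) w)) => m2.
move=> /eqP; rewrite 2!subr_eq => /eqP -> /eqP; rewrite 2!subr_eq => /eqP ->.
rewrite !(linB, insN1 B_ins, insM2 B_ins) !(scalerDr, scalerN, scaleNr) !mulrA.
abel.
Qed.

Lemma skew_iota x y u v :
  commutator_span (B x (iota u) (iota v) * y + B y (iota v) (iota u) * x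
    - lam *: (iota v * y * (iota u * x) - y * iota v * (x * iota u))).
Proof.
pose C := @commutator_span F A.
(* Flipping the tensor while exchanging x and y changes p x q y into q y p x, its rotation. *)
have comm t : C (sw x t * y - sw y (tensor_perm12 t) * x).
  elim/tensor_ind: t => [p q|s t Hs Ht].
    rewrite tensor_perm12E !swE.
    have := commutator_spanE (iota p * x) (iota q * y).
    by rewrite /C !mulrA.
  rewrite (lin_add (tensor_perm12_linear (V := V))) !(lin_add (sw_linear _)) !mulrDl.
  by have := in_spanD Hs Ht; rewrite addrACA -opprD.
have E : br (v *t u) = lam *: (v *t u - u *t v) - tensor_perm12 (br (u *t v)).
  by rewrite -(br_lie.1 v u) addrK.
rewrite !B_br E (lin_affine _ _ _ _ (sw_linear y)) !swE.
(* The lambda terms add up to -lambda times the commutator of u and y v x. *)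
have := in_spanD (comm (br (u *t v)))
  (in_spanZ (- lam) (commutator_spanE (iota u) (y * iota v * x))).
congr in_span.
generalize (sw y (tensor_perm12 (br (u *t v)))) (sw x (br (u *t v))) => z t.
rewrite mulrBl -scalerAl !(mulrBl, scalerBr, scaleNr, mulrA).
abel.
Qed.

End GeneratorFormulas.

(** * Derivations with values in a bimodule *)

Section Bimodules.
Variables (F : fieldType) (A : algType F) (M : lmodType F).

Record bimodule_actions (l : A -> M -> M) (r : M -> A -> M) : Prop := BimoduleActions {
  actl_linear1 : forall m, linear (l^~ m);
  actl_linear2 : forall a, linear (l a);
  actr_linear1 : forall m, linear (r m);
  actr_linear2 : forall a, linear (r^~ a);
  act1l : forall m, l 1 m = m;
  actr1 : forall m, r m 1 = m;
  actMl : forall a b m, l (a * b) m = l a (l b m);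
  actrM : forall a b m, r m (a * b) = r (r m a) b;
  actlr : forall a b m, l a (r m b) = r (l a m) b
}.

Definition leibniz (l : A -> M -> M) (r : M -> A -> M) (d : A -> M) : Prop :=
  forall a b, d (a * b) = l a (d b) + r (d a) b.

Lemma leibniz1 l r d : bimodule_actions l r -> leibniz l r d -> d 1 = 0.
Proof.
move=> lr d_leib; apply: (addIr (d 1)).
by have := d_leib 1 1; rewrite mulr1 (act1l lr) (actr1 lr) add0r.
Qed.

Lemma leibniz_of_gen (I : Type) (gen : I -> A) l r d (g : I -> M) :
    generated_by gen -> bimodule_actions l r -> linear d -> d 1 = 0 ->
    (forall i a, d (gen i * a) = l (gen i) (d a) + r (g i) a) ->
  leibniz l r d.
Proof.
move=> A_gen act d_lin d1 dM a b; elim/A_gen: a => [|a a' IH IH'|k a IH|i a IH].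
- by rewrite mul1r (act1l act) d1 (lin_0 (actr_linear2 act b)) addr0.
- rewrite mulrDl !(lin_add d_lin) IH IH' (lin_add (actl_linear1 act _)).
  by rewrite (lin_add (actr_linear2 act b)) addrACA.
- rewrite -scalerAl !(lin_scale _ _ d_lin) IH (lin_scale _ _ (actl_linear1 act _)).
  by rewrite (lin_scale _ _ (actr_linear2 act b)) scalerDr.
rewrite -mulrA !dM IH (lin_add (actl_linear2 act _)).
rewrite (lin_add (actr_linear2 act b)) (actMl act) (actrM act) (actlr act).
by rewrite addrA.
Qed.

Lemma leibniz_unique (I : Type) (gen : I -> A) l r d d' :
    generated_by gen -> bimodule_actions l r -> linear d -> linear d' ->
    leibniz l r d -> leibniz l r d' -> (forall i, d (gen i) = d' (gen i)) ->
  d =1 d'.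
Proof.
move=> A_gen act dl d'l dM d'M dd' a.
elim/A_gen: a => [|a b IHa IHb|k a IHa|i a IHa].
- by rewrite (leibniz1 act dM) (leibniz1 act d'M).
- by rewrite (lin_add dl) (lin_add d'l) IHa IHb.
- by rewrite (lin_scale _ _ dl) (lin_scale _ _ d'l) IHa.
by rewrite dM d'M dd' IHa.
Qed.

(* p a c extends d i c from a = gen i to all a as a derivation for (li, ri);  *)
(* as the two bimodule structures commute, p a stays a derivation for (lo, ro).*)
Section IteratedDerivation.
Variables (I : Type) (gen : I -> A).
Variables (lo li : A -> M -> M) (ro ri : M -> A -> M).
Variables (d : I -> A -> M) (p : A -> A -> M).
Hypothesis A_gen : generated_by gen.
Hypothesis actI : bimodule_actions li ri.
Hypothesis actO : bimodule_actions lo ro.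
Hypothesis lo_li : forall a b m, lo b (li a m) = li a (lo b m).
Hypothesis lo_ri : forall a b m, lo b (ri m a) = ri (lo b m) a.
Hypothesis ro_li : forall a c m, ro (li a m) c = li a (ro m c).
Hypothesis ro_ri : forall a c m, ro (ri m a) c = ri (ro m c) a.
Hypothesis d_linear : forall i, linear (d i).
Hypothesis d_leib : forall i, leibniz lo ro (d i).
Hypothesis p_linear : forall c, linear (p^~ c).
Hypothesis p_leib : forall c, leibniz li ri (p^~ c).
Hypothesis p_gen : forall i c, p (gen i) c = d i c.

Let p1 c : p 1 c = 0. Proof. exact: leibniz1 actI (p_leib c). Qed.
Let p_genM i a c : p (gen i * a) c = li (gen i) (p a c) + ri (d i c) a.
Proof. by rewrite (p_leib c) p_gen. Qed.

Lemma iterated_linear a : linear (p a).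
Proof.
elim/A_gen: a => [|a b IHa IHb|k a IHa|i a IHa] l u v.
- by rewrite !p1 scaler0 addr0.
- by rewrite !(lin_add (p_linear _)) IHa IHb scalerDr addrACA.
- by rewrite !(lin_scale _ _ (p_linear _)) IHa scalerDr !scalerA mulrC.
rewrite !p_genM IHa (actl_linear2 actI) d_linear (actr_linear2 actI).
by rewrite scalerDr addrACA.
Qed.

Lemma iterated_leibniz a : leibniz lo ro (p a).
Proof.
elim/A_gen: a => [|a b IHa IHb|k a IHa|i a IHa] u v.
- by rewrite !p1 (lin_0 (actl_linear2 actO u)) (lin_0 (actr_linear2 actO v)) addr0.
- rewrite !(lin_add (p_linear _)) IHa IHb.
  by rewrite (lin_add (actl_linear2 actO u)) (lin_add (actr_linear2 actO v)) addrACA.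
- rewrite !(lin_scale _ _ (p_linear _)) IHa.
  rewrite (lin_scale _ _ (actl_linear2 actO u)) (lin_scale _ _ (actr_linear2 actO v)).
  by rewrite scalerDr.
rewrite !p_genM IHa d_leib.
rewrite (lin_add (actl_linear2 actO u)) (lin_add (actr_linear2 actO v)).
rewrite (lin_add (actl_linear2 actI _)) (lin_add (actr_linear2 actI a)).
by rewrite lo_li lo_ri ro_li ro_ri addrACA.
Qed.

End IteratedDerivation.
End Bimodules.

(** * The outer and inner bimodule structures on A (x) A *)

Section TensorActions.
Variables (F : fieldType) (A : algType F).

Lemma tmulA (s t u : tensor A A) : tmul s (tmul t u) = tmul (tmul s t) u.
Proof.
move: s; apply: tensor_lin_ext => [||a b].
- exact: tmul_linearl.
- exact: (linear_comp (tmul_linearl u) (tmul_linearl t)).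
move: t; apply: tensor_lin_ext => [||c d].
- exact: (linear_comp (tmul_linearr _) (tmul_linearl u)).
- exact: (linear_comp (tmul_linearl u) (tmul_linearr _)).
move: u; apply: tensor_lin_ext => [||e f].
- exact: (linear_comp (tmul_linearr _) (tmul_linearr _)).
- exact: tmul_linearr.
by rewrite !tmulE !mulrA.
Qed.

Lemma outer_actions : bimodule_actions
  (fun (b : A) (m : tensor A A) => tmul (b *t 1) m) (fun m c => tmul m (1 *t c)).
Proof.
split.
- by move=> m k u v; rewrite tensDl tensZl; apply: tmul_linearl.
- by move=> a; apply: tmul_linearr.
- by move=> m k u v; rewrite tensDr tensZr; apply: tmul_linearr.
- by move=> a; apply: tmul_linearl.
- exact: tmul11l.
- exact: tmul11r.
- by move=> a b m; rewrite tmulA tmulE mulr1.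
- by move=> a b m; rewrite -tmulA tmulE mulr1.
- by move=> a b m; rewrite tmulA.
Qed.

Lemma inner_actions : bimodule_actions
  (fun (a : A) (m : tensor A A) => tmul (1 *t a) m) (fun m b => tmul m (b *t 1)).
Proof.
split.
- by move=> m k u v; rewrite tensDr tensZr; apply: tmul_linearl.
- by move=> a; apply: tmul_linearr.
- by move=> m k u v; rewrite tensDl tensZl; apply: tmul_linearr.
- by move=> a; apply: tmul_linearl.
- exact: tmul11l.
- exact: tmul11r.
- by move=> a b m; rewrite tmulA tmulE mulr1.
- by move=> a b m; rewrite -tmulA tmulE mulr1.
- by move=> a b m; rewrite tmulA.
Qed.

End TensorActions.

(** * Derivations of the free algebra *)

Section FreeAlgebraDerivations.
Variables (F : fieldType) (n : nat).
Local Notation A := (free_algebra F n).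
Local Notation gen := (@free_gen F n).

Definition word_mon (s : seq 'I_n) : A := << FMonom s >>.

Lemma word_mon_nil : word_mon [::] = 1.
Proof. by rewrite /word_mon -fmoneE. Qed.

Lemma word_mon_cons i s : word_mon (i :: s) = gen i * word_mon s.
Proof.
rewrite /word_mon /free_gen malgM_def fgmulUU mulr1; congr (<< _ *g _ >>).
by rewrite /mmul /= fmmulE fmuE.
Qed.

Lemma free_algebraE (a : A) : a = \sum_(k <- msupp a) a@_k *: word_mon k.
Proof.
rewrite {1}[a]monalgE; apply: eq_bigr => k _; apply/malgP => k'.
by rewrite mcoeffZ !mcoeffU fmK mulr_natr.
Qed.

Lemma free_algebra_word_ind (P : A -> Prop) :
    (forall s, P (word_mon s)) -> (forall x y, P x -> P y -> P (x + y)) ->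
    (forall k x, P x -> P (k *: x)) ->
  forall a, P a.
Proof.
move=> Pw PD PZ a; rewrite (free_algebraE a).
elim: (enum_fset _) => [|k s IHs].
  by rewrite big_nil -(scale0r (word_mon [::])); apply: PZ.
by rewrite big_cons; apply/PD/IHs/PZ.
Qed.

Lemma free_algebra_generated : generated_by gen.
Proof.
move=> P P1 PD PZ Pgen; apply: free_algebra_word_ind => //.
by elim=> [|i w IHw]; [rewrite word_mon_nil | rewrite word_mon_cons; apply: Pgen].
Qed.

Variable M : lmodType F.

Lemma word_lin_ext (f h : A -> M) : linear f -> linear h ->
  (forall s, f (word_mon s) = h (word_mon s)) -> f =1 h.
Proof.
move=> fl hl fh; elim/free_algebra_word_ind=> [s|a b fa fb|k a fa] //.
- by rewrite (lin_add fl) (lin_add hl) fa fb.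
- by rewrite (lin_scale _ _ fl) (lin_scale _ _ hl) fa.
Qed.

Definition word_extend (h : seq 'I_n -> M) (a : A) : M :=
  \sum_(k <- msupp a) a@_k *: h k.

Let word_extendEw h (d : {fset {fmonom 'I_n}}) (a : A) : (msupp a `<=` d)%fset ->
  word_extend h a = \sum_(k <- d) a@_k *: h k.
Proof.
move=> le; rewrite [LHS](big_fset_incl _ le) => //= x xd /mcoeff_outdom ->.
by rewrite scale0r.
Qed.

Lemma word_extend_linear h : linear (word_extend h).
Proof.
move=> c a b; pose d := (msupp (c *: a + b) `|` msupp a `|` msupp b)%fset.
rewrite !(@word_extendEw h d) /d; first last.
- by rewrite -fsetUA fsubsetUl.
- by rewrite fsetUAC fsubsetUr.
- by rewrite fsubsetUr.
rewrite scaler_sumr -big_split; apply: eq_bigr => p _ /=.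
by rewrite mcoeffD mcoeffZ scalerDl scalerA.
Qed.

Lemma word_extend_mon h s : word_extend h (word_mon s) = h s.
Proof. by rewrite (word_extendEw _ msuppU_le) big_seq_fset1 mcoeffUU scale1r. Qed.

Variables (l : A -> M -> M) (r : M -> A -> M) (g : 'I_n -> M).
Hypothesis act : bimodule_actions l r.

(** The Leibniz rule read off the first letter; the value on the empty word must be 0, as every
    derivation kills 1. *)
Fixpoint der_word (s : seq 'I_n) : M :=
  if s is i :: s' then l (gen i) (der_word s') + r (g i) (word_mon s') else 0.

Definition free_der : A -> M := word_extend der_word.

Lemma free_der_linear : linear free_der.
Proof. exact: word_extend_linear. Qed.

Lemma free_der_genM i a : free_der (gen i * a) = l (gen i) (free_der a) + r (g i) a.
Proof.
have mul_lin : linear ( *%R (gen i)) by move=> k u v; rewrite mulrDr scalerAr.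
have L1 := linear_comp (actl_linear2 act (gen i)) free_der_linear.
move: a; apply: (word_lin_ext (linear_comp free_der_linear mul_lin)) => [|s].
  exact: (linear_add L1 (actr_linear1 act (g i))).
by rewrite -word_mon_cons /free_der !word_extend_mon.
Qed.

Lemma free_der1 : free_der 1 = 0.
Proof. by rewrite -word_mon_nil /free_der word_extend_mon. Qed.

Lemma free_der_gen i : free_der (gen i) = g i.
Proof.
by rewrite -[gen i]mulr1 free_der_genM free_der1 (lin_0 (actl_linear2 act _)) add0r (actr1 act).
Qed.

Lemma free_der_leibniz : leibniz l r free_der.
Proof.
apply: (leibniz_of_gen free_algebra_generated act free_der_linear free_der1).
exact: free_der_genM.
Qed.

End FreeAlgebraDerivations.

(** * Double brackets: identities, uniqueness and existence *)

Section DoubleBrackets.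
Variables (F : fieldType) (A : algType F).

Lemma tmap_linear (U U' V V' : lmodType F) (f : {linear U -> U'}) (g : {linear V -> V'}) :
  linear (tmap f g).
Proof.
apply: tlift_linear; split=> [w a x y|w a x y] /=.
  by rewrite linearP tensDl tensZl.
by rewrite linearP tensDr tensZr.
Qed.

Lemma tensor_mu_linear : linear (@tensor_mu F A).
Proof.
apply: tlift_linear; split=> [w k u v|w k u v] /=; first by rewrite mulrDl -scalerAl.
by rewrite mulrDr -scalerAr.
Qed.

Lemma tensor_mu_sandwich (t : tensor A A) : tensor_mu t = sandwich 1 t.
Proof.
move: t; apply: (tensor_lin_ext tensor_mu_linear (sandwich_linear 1)) => u v.
by rewrite tensor_muE sandwichE mulr1.
Qed.

Lemma bracket_inserted (Br : {linear tensor A A -> tensor A A}) :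
  derivation_right Br -> derivation_left Br ->
  inserted_bracket (fun x a b => sandwich x (Br (a *t b))).
Proof.
move=> Br_r Br_l; have Br_lin : linear Br by exact: linearP.
split.
- by move=> a b; apply: sandwich_linearl.
- move=> x b; apply: (linear_comp (linear_comp (sandwich_linear x) Br_lin)).
  by move=> k u v; rewrite tensDl tensZl.
- move=> x a; apply: (linear_comp (linear_comp (sandwich_linear x) Br_lin)).
  by move=> k u v; rewrite tensDr tensZr.
- by move=> x a b c; rewrite (Br_l a b c); apply: sandwich_inner.
- by move=> x a b c; rewrite (Br_r a b c); apply: sandwich_outer.
Qed.

(** The generating family is [iota] itself, indexed by all vectors of V, so that the axioms on V
    apply directly to generators. *)
Lemma modified_double_poisson_of_generators (V : lmodType F) (lam : F)
    (br : {linear tensor V V -> tensor V V}) (iota : {linear V -> A})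
    (Br : {linear tensor A A -> tensor A A}) :
  generated_by iota -> double_lie br lam -> derivation_right Br -> derivation_left Br ->
  (forall u v, Br (iota u *t iota v) = tmap iota iota (br (u *t v))) ->
  modified_double_poisson Br.
Proof.
move=> A_gen br_lie Br_r Br_l Br_br.
pose B x a b := sandwich x (Br (a *t b)).
have B_ins : inserted_bracket B := bracket_inserted Br_r Br_l.
pose sw x t := sandwich x (tmap iota iota t).
have sw_lin x : linear (sw x) := linear_comp (sandwich_linear x) (tmap_linear iota iota).
have swE x p q : sw x (p *t q) = iota p * x * iota q by rewrite /sw tmapE sandwichE.
pose sw3 x y : tensor (tensor V V) V -> A := tlift (fun t r => sw x t * y * iota r).
have sw3_bil x y : bilinear_map (fun t r => sw x t * y * iota r).
  split=> [r k u v|t k u v] /=; first by rewrite sw_lin !mulrDl -!scalerAl.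
  by rewrite linearP mulrDr -scalerAr.
have sw3_lin x y : linear (sw3 x y) := tlift_linear (sw3_bil x y).
have sw3E x y t r : sw3 x y (t *t r) = sw x t * y * iota r := tliftE (sw3_bil x y) t r.
have B_br x u v : B x (iota u) (iota v) = sw x (br (u *t v)).
  by rewrite /B Br_br.
have jacG := jac_iota br_lie B_ins sw_lin swE sw3_lin sw3E B_br.
have skewG := skew_iota br_lie sw_lin swE B_br.
have mu1 a b : mu_br Br a b = B 1 a b := tensor_mu_sandwich _.
split=> // [a b c|a b].
  by rewrite !mu1; apply: (ins_jacobi A_gen B_ins jacG).
by rewrite !mu1; apply: (ins_skew A_gen B_ins skewG).
Qed.

(** For fixed c both brackets are inner derivations in a, which reduces a to a generator; then both
    are outer derivations in c. *)
Lemma double_bracket_unique (I : Type) (gen : I -> A)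
    (Br Br' : {linear tensor A A -> tensor A A}) :
  generated_by gen -> derivation_right Br -> derivation_left Br ->
  derivation_right Br' -> derivation_left Br' ->
  (forall i j, Br' (gen i *t gen j) = Br (gen i *t gen j)) -> forall t, Br' t = Br t.
Proof.
move=> A_gen Br_r Br_l Br'_r Br'_l Br_gen.
have lin1 (f : {linear tensor A A -> tensor A A}) c : linear (fun a => f (a *t c)).
  by move=> k u v; rewrite tensDl tensZl linearP.
have lin2 (f : {linear tensor A A -> tensor A A}) a : linear (fun c => f (a *t c)).
  by move=> k u v; rewrite tensDr tensZr linearP.
apply: tensor_lin_ext => [||a c]; [exact: linearP | exact: linearP |].
have inner := inner_actions A; have outer := outer_actions A.
apply: (leibniz_unique A_gen inner (lin1 Br' c) (lin1 Br c)) => [u v|u v|i].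
- exact: Br'_l.
- exact: Br_l.
apply: (leibniz_unique A_gen outer (lin2 Br' (gen i)) (lin2 Br (gen i))) => [u v|u v|j].
- exact: Br'_r.
- exact: Br_r.
exact: Br_gen.
Qed.

(** Actions on opposite sides commute by associativity, those on the same side because x (x) 1 and 1
    (x) y commute. *)
Lemma tmul_outer_inner :
  [/\ forall (a b : A) m, tmul (b *t 1) (tmul (1 *t a) m) = tmul (1 *t a) (tmul (b *t 1) m),
      forall (a b : A) m, tmul (b *t 1) (tmul m (a *t 1)) = tmul (tmul (b *t 1) m) (a *t 1),
      forall (a b : A) m, tmul (tmul (1 *t a) m) (1 *t b) = tmul (1 *t a) (tmul m (1 *t b)) &
      forall (a b : A) m, tmul (tmul m (a *t 1)) (1 *t b) = tmul (tmul m (1 *t b)) (a *t 1)].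
Proof.
have E (x y : A) : tmul (x *t 1) (1 *t y) = tmul (1 *t y) (x *t 1).
  by rewrite !tmulE !mulr1 !mul1r.
split=> a b m.
- exact: (etrans (tmulA _ _ m)
    (etrans (congr1 (fun s => tmul s m) (E b a)) (esym (tmulA _ _ m)))).
- exact: tmulA.
- exact/esym/tmulA.
exact: (etrans (esym (tmulA m _ _)) (etrans (congr1 (tmul m) (E a b)) (tmulA m _ _))).
Qed.

Lemma double_bracket_of_map (p : A -> A -> tensor A A) :
    bilinear_map p ->
    (forall a, leibniz (fun b m => tmul (b *t 1) m) (fun m c => tmul m (1 *t c)) (p a)) ->
    (forall c, leibniz (fun a m => tmul (1 *t a) m) (fun m b => tmul m (b *t 1)) (p^~ c)) ->
  exists Br : {linear tensor A A -> tensor A A},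
    [/\ forall a c, Br (a *t c) = p a c, derivation_right Br & derivation_left Br].
Proof.
move=> p_bil p_r p_l.
pose p_linear :=
  GRing.isLinear.Build F (tensor A A) (tensor A A) *:%R (tlift p) (tlift_linear p_bil).
have [Br BrE] : exists Br : {linear tensor A A -> tensor A A},
    forall a c, Br (a *t c) = p a c.
  pose Br : {linear tensor A A -> tensor A A} := HB.pack (tlift p) p_linear.
  by exists Br; apply: (tliftE p_bil).
exists Br; split=> [|a b c|a b c]; first exact: BrE.
  by rewrite !BrE; apply: p_r.
by rewrite !BrE; apply: p_l.
Qed.

End DoubleBrackets.

(** [d i] extends the values t i j to the second argument as an outer derivation; [p] then extends
    [d i c] to the first argument as an inner one. That [p a] is still linear and an outer
    derivation in c is [iterated_linear] and [iterated_leibniz]. *)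
Lemma double_bracket_exists (F : fieldType) (n : nat)
    (t : 'I_n -> 'I_n -> tensor (free_algebra F n) (free_algebra F n)) :
  exists Br : {linear tensor (free_algebra F n) (free_algebra F n)
               -> tensor (free_algebra F n) (free_algebra F n)},
    [/\ forall i j, Br (free_gen F i *t free_gen F j) = t i j,
        derivation_right Br & derivation_left Br].
Proof.
set A := free_algebra F n.
have inner := inner_actions A; have outer := outer_actions A.
pose d i := free_der (fun (b : A) m => tmul (b *t 1) m) (fun m c => tmul m (1 *t c)) (t i).
pose p a c := free_der (fun (a : A) m => tmul (1 *t a) m) (fun m b => tmul m (b *t 1))
  (fun i => d i c) a.
have p_lin c : linear (p^~ c) := free_der_linear _ _ _.
have p_leib c := free_der_leibniz (fun i => d i c) inner.
have d_leib i := free_der_leibniz (t i) outer.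
have d_lin i : linear (d i) := free_der_linear _ _ _.
have p_gen i c : p (free_gen F i) c = d i c := free_der_gen _ inner i.
have p_lin2 a : linear (p a) := iterated_linear (@free_algebra_generated F n) inner
  d_lin p_lin p_leib p_gen a.
have p_leib2 a : leibniz (fun b m => tmul (b *t 1) m) (fun m c => tmul m (1 *t c)) (p a).
  have [C1 C2 C3 C4] := tmul_outer_inner A.
  exact: (iterated_leibniz (@free_algebra_generated F n) inner outer C1 C2 C3 C4
    d_leib p_lin p_leib p_gen a).
have p_bil : bilinear_map p by split=> [c|a]; [apply: p_lin | apply: p_lin2].
have [Br [BrE Br_r Br_l]] := double_bracket_of_map p_bil p_leib2 p_leib.
exists Br; split=> // i j.
exact: (etrans (BrE _ _) (etrans (p_gen _ _) (free_der_gen (t i) outer j))).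
Qed.

Lemma basis_lin_ext (F : fieldType) (V : vectType F) (W : lmodType F) n (e : n.-tuple V)
    (f g : V -> W) :
  basis_of fullv e -> linear f -> linear g -> (forall i : 'I_n, f e`_i = g e`_i) -> f =1 g.
Proof.
move=> e_basis fl gl fg v; rewrite (coord_basis e_basis (memvf v)).
elim: (index_enum _) => [|i s IHs]; first by rewrite !big_nil (lin_0 fl) (lin_0 gl).
rewrite !big_cons (lin_add fl) (lin_add gl) IHs.
by rewrite (lin_scale _ _ fl) (lin_scale _ _ gl) fg.
Qed.

Theorem theorem9 (F : fieldType) (lam : F) (V : vectType F)
    (br : {linear tensor V V -> tensor V V}) (n : nat) (e : n.-tuple V) :
  lam != 0 -> basis_of fullv e -> double_lie br lam ->
  exists Br : {linear tensor (free_algebra F n) (free_algebra F n)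
               -> tensor (free_algebra F n) (free_algebra F n)},
    [/\ extends_bracket e br Br, derivation_right Br & derivation_left Br] /\
    (forall Br' : {linear tensor (free_algebra F n) (free_algebra F n)
                   -> tensor (free_algebra F n) (free_algebra F n)},
       extends_bracket e br Br' -> derivation_right Br' ->
       derivation_left Br' -> forall t, Br' t = Br t) /\
    modified_double_poisson Br.
Proof.
move=> _ e_basis br_lie.
set iota : {linear V -> free_algebra F n} := basis_embed e.
have iota_gen (i : 'I_n) : iota e`_i = free_gen F i := basis_embed_gen i e_basis.
have [Br [Br_gen Br_r Br_l]] :=
  double_bracket_exists (fun i j : 'I_n => tmap iota iota (br (e`_i *t e`_j))).
(* Only pairs of basis vectors were prescribed; bilinearity gives all of V. *)
have Br_br u v : Br (iota u *t iota v) = tmap iota iota (br (u *t v)).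
  have tm := tmap_linear iota iota.
  have br_lin : linear br by exact: linearP.
  have Br_lin : linear Br by exact: linearP.
  move: u; apply: (basis_lin_ext e_basis) => [||i].
  - by apply: (linear_comp Br_lin) => k x y; rewrite linearP tensDl tensZl.
  - apply: (linear_comp tm); apply: (linear_comp br_lin) => k x y.
    by rewrite tensDl tensZl.
  move: v; apply: (basis_lin_ext e_basis) => [||j].
  - by apply: (linear_comp Br_lin) => k x y; rewrite linearP tensDr tensZr.
  - apply: (linear_comp tm); apply: (linear_comp br_lin) => k x y.
    by rewrite tensDr tensZr.
  by rewrite !iota_gen Br_gen.
have iota_A : generated_by iota.
  move=> P P1 PD PZ Pgen; apply: free_algebra_generated => // i x Px.
  by rewrite -iota_gen; apply: Pgen.
exists Br; split; first by split.
split=> [Br' Br'_br Br'_r Br'_l|].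
  apply: (double_bracket_unique iota_A Br_r Br_l Br'_r Br'_l) => u v.
  by rewrite Br_br; apply: Br'_br.
exact: (modified_double_poisson_of_generators iota_A br_lie Br_r Br_l Br_br).
Qed.
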